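(* Let $(X,\tau,E)$ be a soft topological space and let $\{(Y_\alpha,\tau_{Y_\alpha},E)\}_{\alpha\in J}$, with $J$ nonempty, be a family of soft subspaces of $(X,\tau,E)$, each of which is soft connected, such that $\bigcap_{\alpha\in J}\widetilde{Y_\alpha}\neq\Phi_E$. Put $Y=\bigcup_{\alpha\in J}Y_\alpha$. Then the soft subspace $(Y,\tau_Y,E)$ of $(X,\tau,E)$ is soft connected.
   Context: Let $X$ be a set and $E$ a set of parameters. A soft set $(F,E)$ over $X$ is a map $F:E\to\mathcal{P}(X)$; $SS(X)_E$ is the family of all of them. Unions and intersections are taken parameterwise. $\Phi_E$ is the null soft set $e\mapsto\emptyset$; for $Y\subseteq X$, $\widetilde{Y}$ is the soft set $e\mapsto Y$. A soft topological space $(X,\tau,E)$ is given by a family $\tau\subseteq SS(X)_E$ containing $\Phi_E$ and $\widetilde{X}$ and closed under arbitrary unions and finite intersections; members of $\tau$ are called soft open. A soft separation of $\widetilde{X}$ is a pair of soft open sets, both different from $\Phi_E$, whose union is $\widetilde{X}$ and whose intersection is $\Phi_E$. The space is soft connected if no soft separation of $\widetilde{X}$ exists. For a nonempty subset $Y\subseteq X$, the soft relative topology is $\tau_Y=\{\widetilde{Y}\cap(F,E) : (F,E)\in\tau\}$, and $(Y,\tau_Y,E)$ is called a soft subspace of $(X,\tau,E)$. *)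

(* Defs.v *)
From mathcomp Require Import all_boot all_order.
From mathcomp Require Import boolp classical_sets.

Set Implicit Arguments.
Unset Strict Implicit.
Unset Printing Implicit Defensive.

Local Open Scope classical_set_scope.

Section SoftSets.
Context {U E : Type}.

Definition soft_set := E -> set U.

(* The underlying set of a soft space is a subset of an ambient type U, so that
   a space (X, tau, E) and its subspaces (Y, tau_Y, E) are objects of one kind.
   SS X is the family of all soft sets over X. *)
Definition SS (X : set U) : set soft_set :=
  [set F | forall e, F e `<=` X].

Definition soft_null : soft_set := fun=> set0.

Definition soft_const (Y : set U) : soft_set := fun=> Y.

Definition soft_union (F G : soft_set) : soft_set :=
  fun e => F e `|` G e.

Definition soft_inter (F G : soft_set) : soft_set :=
  fun e => F e `&` G e.

Definition soft_bigcup (I : Type) (P : set I) (F : I -> soft_set) :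
  soft_set := fun e => \bigcup_(i in P) F i e.

Definition soft_bigcap (I : Type) (P : set I) (F : I -> soft_set) :
  soft_set := fun e => \bigcap_(i in P) F i e.

(* Nonempty finite intersections follow from binary ones; the empty one,
   taken inside X, is soft_const X. *)
Record soft_topology (X : set U) (tau : set soft_set) : Prop :=
  SoftTopology {
    soft_open_sub : tau `<=` SS X ;
    soft_open_null : tau soft_null ;
    soft_open_full : tau (soft_const X) ;
    soft_open_bigcup : forall G : set soft_set,
      G `<=` tau -> tau (soft_bigcup G id) ;
    soft_open_inter : forall F G : soft_set,
      tau F -> tau G -> tau (soft_inter F G) }.

Definition soft_separation (X : set U) (tau : set soft_set)
    (F G : soft_set) : Prop :=
  [/\ tau F /\ tau G, F <> soft_null /\ G <> soft_null,
      soft_union F G = soft_const X & soft_inter F G = soft_null].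

Definition soft_connected (X : set U) (tau : set soft_set) : Prop :=
  ~ exists F G, soft_separation X tau F G.

Definition soft_relative (tau : set soft_set) (Y : set U) :
  set soft_set := [set soft_inter (soft_const Y) F | F in tau].

Lemma soft_relative_topology (X : set U) (tau : set soft_set) (Y : set U) :
  soft_topology X tau -> Y `<=` X -> soft_topology Y (soft_relative tau Y).
Proof.
move=> [_ t0 tX tU tI] YX; split.
- by move=> _ [F _ <-] e x [].
- exists soft_null => //; apply: funext => e; exact: setI0.
- exists (soft_const X) => //; apply: funext => e; exact: setIidl.
- move=> G Gtau.
  exists (soft_bigcup [set F | tau F /\ G (soft_inter (soft_const Y) F)] id).
    by apply: tU => F [].
  apply: funext => e; apply/seteqP; split => x.
    move=> [Yx [F [_ GF] Fx]].
    by exists (soft_inter (soft_const Y) F).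
  move=> [H GH Hx]; have [F tF FH] := Gtau _ GH.
  move: GH Hx; rewrite -FH => GH [Yx Fx].
  by split => //; exists F.
- move=> _ _ [F tF <-] [G tG <-]; exists (soft_inter F G); first exact: tI.
  by apply: funext => e; rewrite /soft_inter setIACA setIid.
Qed.

End SoftSets.

Arguments soft_set : clear implicits.

(* Main.v *)
(* A soft separation (F, G) of a soft space restricts to any connected soft
   subspace Z, so F or G vanishes on Z. A point x common to all the subspaces
   lies, at some parameter e, in one of F e and G e; the other soft set then
   vanishes on every subspace, hence on their union. *)

Require Import Defs.
From mathcomp Require Import all_boot all_order.
From mathcomp Require Import boolp classical_sets.

Set Implicit Arguments.
Unset Strict Implicit.
Unset Printing Implicit Defensive.

Local Open Scope classical_set_scope.

Section SoftSeparation.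
Context {U E : Type}.
Implicit Types (tau : set (soft_set U E)) (F G : soft_set U E).

Lemma soft_separation_sym (X : set U) tau F G :
  soft_separation X tau F G -> soft_separation X tau G F.
Proof.
move=> [[tF tG] [F0 G0] FG FGI]; split => //.
- by rewrite -FG; apply: funext => e; exact: setUC.
- by rewrite -FGI; apply: funext => e; exact: setIC.
Qed.

(** Relative topologies are transitive: if [F] is the trace on [Y] of [H], the same [H] has trace
    [Z] ∩ [F] on [Z], as [Z] ∩ [Y] = [Z]. *)
Lemma soft_relative_restrict tau (Y Z : set U) F :
  Z `<=` Y -> soft_relative tau Y F ->
  soft_relative tau Z (soft_inter (soft_const Z) F).
Proof.
move=> ZY [H tH <-]; exists H => //; apply: funext => e.
by rewrite /soft_inter /soft_const setIA (setIidl ZY).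
Qed.

(** Otherwise the two traces on [Z] would form a soft separation of [Z]. *)
Lemma soft_connected_separation tau (Y Z : set U) F G :
  Z `<=` Y -> soft_connected Z (soft_relative tau Z) ->
  soft_separation Y (soft_relative tau Y) F G ->
  soft_inter (soft_const Z) F = soft_null \/
  soft_inter (soft_const Z) G = soft_null.
Proof.
move=> ZY cZ [[tF tG] _ FG FGI]; apply: contrapT => /not_orP[F0 G0].
apply: cZ; exists (soft_inter (soft_const Z) F), (soft_inter (soft_const Z) G).
split => //; first by split; apply: soft_relative_restrict; eassumption.
- apply: funext => e; have /= FGe := congr1 (@^~ e) FG.
  rewrite /soft_union /soft_inter -setIUr; move: FGe; rewrite /soft_union => ->.
  exact: setIidl.
- apply: funext => e; have /= FGe := congr1 (@^~ e) FGI.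
  rewrite /soft_inter setIACA; move: FGe; rewrite /soft_inter => ->.
  exact: setI0.
Qed.

(** Calling [F] the side that contains [x] loses nothing, since separations are symmetric. *)
Lemma soft_separation_bigcup_avoid tau (J : Type) (Y : J -> set U) F G
    (e : E) (x : U) :
  (forall a, soft_connected (Y a) (soft_relative tau (Y a))) ->
  (forall a, Y a x) -> F e x ->
  ~ soft_separation (\bigcup_a Y a) (soft_relative tau (\bigcup_a Y a)) F G.
Proof.
move=> cY Yx Fx sFG; have [[_ [H _ GE]] [_ +] _ _] := sFG; apply.
apply: funext => e'; apply/seteqP; split => // y Gy.
(* Relative openness keeps [G] inside the union, so [y] lies in some [Y a]. *)
have : (soft_inter (soft_const (\bigcup_a Y a)) H) e' y by rewrite GE.
move=> [[a _ Yay] _].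
have YaY : Y a `<=` \bigcup_a Y a by exact: bigcup_sup.
(* On this [Y a], [x] keeps [F] from vanishing at [e] and [y] keeps [G] from vanishing at [e']; the
   two parameters may differ, as being null concerns all of them. *)
have [/(congr1 (@^~ e)) F0|/(congr1 (@^~ e')) G0] :=
  soft_connected_separation YaY (cY a) sFG.
- have : soft_inter (soft_const (Y a)) F e x by split; [exact: Yx|].
  by rewrite F0.
- have : soft_inter (soft_const (Y a)) G e' y by [].
  by rewrite G0.
Qed.

End SoftSeparation.

Theorem theorem2p16 (U E : Type) (X : set U) (tau : set (soft_set U E))
    (J : Type) (Y : J -> set U) :
  soft_topology X tau ->
  [set: J] !=set0 ->
  (forall a : J, Y a !=set0 /\ Y a `<=` X) ->
  (forall a : J, soft_connected (Y a) (soft_relative tau (Y a))) ->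
  soft_bigcap [set: J] (fun a => soft_const (Y a)) <> @soft_null U E ->
  soft_connected (\bigcup_a Y a) (soft_relative tau (\bigcup_a Y a)).
Proof.
move=> _ [a0 _] _ cY capY [F [G sFG]]; apply: capY.
apply: funext => e; apply/seteqP; split => // x capx.
have Yx a : Y a x by exact: capx.
have [_ _ /(congr1 (@^~ e)) FGe _] := sFG.
(* The index [a0] puts [x] in the union; over an empty [J] the intersection would be all of [U] and
   the union empty. *)
have : soft_union F G e x by rewrite FGe; exists a0.
case=> [Fx|Gx].
- exact: (soft_separation_bigcup_avoid cY Yx Fx sFG).
- exact: (soft_separation_bigcup_avoid cY Yx Gx (soft_separation_sym sFG)).
Qed.
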